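(* Let $p$ be a fixed odd prime. The number of powerfully solvable groups of exponent $p^2$ and order $p^n$, up to isomorphism, is $$p^{\alpha n^3+o(n^3)}\quad\text{as } n\to\infty,\qquad\text{where }\alpha=\frac{-1+\sqrt2}{6}.$$
   Context: $G^{p}$ denotes the subgroup generated by all $p$-th powers of elements of $G$. A chain of subgroups $H_0\ge H_1\ge\cdots\ge H_n$ of a finite $p$-group $G$ is powerfully abelian if $[H_i,H_i]\le H_{i+1}^p$ for $i=0,\ldots,n-1$. A finite $p$-group $G$ is powerfully solvable if there is a powerfully abelian chain $G=G_0\ge G_1\ge\cdots\ge G_n=1$. *)

(* Defs.v *)
From mathcomp Require Import all_boot all_order all_fingroup all_algebra all_solvable.
From mathcomp Require Import all_classical all_reals all_analysis.

Set Implicit Arguments.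
Unset Strict Implicit.
Unset Printing Implicit Defensive.

Import Order.TTheory GRing.Theory Num.Theory.
Import numFieldNormedType.Exports.

Section PowerfullySolvable.
Local Open Scope group_scope.
Variables (p : nat) (gT : finGroupType).
Implicit Types G H K : {group gT}.

Definition power_subgroup H : {set gT} := <<[set x ^+ p | x in H]>>.

Definition powerfully_abelian_chain (H0 : {group gT}) (s : seq {group gT}) :=
  path (fun H K : {group gT} =>
          (K \subset H) && ([~: H, H] \subset power_subgroup K)) H0 s.

Definition powerfully_solvable G : Prop :=
  exists2 s : seq {group gT},
    powerfully_abelian_chain G s & last G s = 1%G.

End PowerfullySolvable.

Lemma cayley_isog (gT : finGroupType) (G : {group gT}) :
  exists2 H : {group 'S_#|G|}, (G \isog H)%g & #|H| = #|G|.
Proof.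
have cardG : #|G| = #|{: subg_of G}| by rewrite -cardsT (card_isog (isog_subg G)).
pose v (i : 'I_#|G|) : subg_of G := enum_val (cast_ord cardG i).
pose r (x : subg_of G) : 'I_#|G| := cast_ord (esym cardG) (enum_rank x).
have rK : cancel r v by move=> x; rewrite /v /r cast_ordKV enum_rankK.
have vK : cancel v r by move=> i; rewrite /v /r enum_valK cast_ordK.
have f_inj x : injective (fun i => r (v i * subg G x)%g).
  by move=> i j /(can_inj rK) /mulIg /(can_inj vK).
pose f x : 'S_#|G| := perm (f_inj x).
have fM : {in G &, {morph f : x y / (x * y)%g}}.
  move=> x y Gx Gy; apply/permP => i.
  by rewrite permM !permE /= rK -mulgA subgM.
have injf : ('injm (Morphism fM))%g.
  apply/injmP => x y Gx Gy /permP /(_ (r 1%g)).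
  rewrite !permE /= !rK !mul1g => /(can_inj rK) /(congr1 sgval).
  by rewrite !subgK.
exists (Morphism fM @* G)%G; last by rewrite card_injm.
exact: sub_isog.
Qed.

(* By cayley_isog, every group of order N is isomorphic to a subgroup of
   'S_N, so that the subgroups of order N of 'S_N represent all isomorphism
   classes of groups of order N. P is meant to be invariant under isomorphism. *)
Definition num_iso_classes (N : nat)
    (P : forall gT : finGroupType, {group gT} -> Prop) : nat :=
  #|equivalence_partition
      (fun G H : {group 'S_N} => G \isog H)
      [set G : {group 'S_N} | (#|G| == N) && `[< P _ G >]]|.

Definition num_powerfully_solvable (p n : nat) : nat :=
  num_iso_classes (p ^ n) (fun gT (G : {group gT}) =>
    exponent G = (p ^ 2)%N /\ powerfully_solvable p G).

(* Main.v *)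
(* In a powerfully solvable group G of exponent p^2, p odd, commutators are
   central of order p, so that x |-> x^p is a homomorphism onto the central
   elementary abelian subgroup P = G^p. With |P| = p^s and |G/P| = p^d, d + s = n,
   G is therefore determined by linear data: the powers of d generators x_i and
   their commutators, all in P = F_p^s. The chain allows us to choose the x_i so
   that, for i < j, [x_i, x_j] lies in the span of the x_k^p with k > i, which has
   dimension at most min(s, d - 1 - i). Up to the n^2 coordinates of the powers
   this leaves at most F(s, d) = sum_(m < d) m min(s, m) parameters, and for
   d >= s, F(s, d) = s d^2/2 - s^3/6 + O(n^2).

   Conversely, for s <= d all F(s, d) parameters can be prescribed, by twisting the
   addition of (Z/p^2)^s x (Z/p)^(d - s), the generators of order p coming first.
   The structure constants are recovered from the images of the d generators under
   an isomorphism, so each isomorphism type is obtained at most |G|^d = p^(nd) times.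

   Finally s d^2/2 - s^3/6 on s + d = n is maximal, with value (-1 + sqrt 2)/6 n^3,
   at s = (1 - 1/sqrt 2) n. *)
Require Import Defs.
From HB Require Import structures.
From mathcomp Require Import all_boot all_order all_fingroup all_algebra all_solvable.
From mathcomp Require Import boolp zify.

Set Implicit Arguments.
Unset Strict Implicit.
Unset Printing Implicit Defensive.

Import GRing.Theory.

(** * Power structure and adapted generators *)

Section PowerfullySolvableGroups.
Local Open Scope group_scope.

Section PowerStructure.
Variables (p : nat) (gT : finGroupType).
Implicit Types G H K : {group gT}.

Canonical power_subgroup_group G := Eval hnf in [group of power_subgroup p G].

Lemma power_subgroupS G H : H \subset G ->
  power_subgroup p H \subset power_subgroup p G.
Proof. by move=> sHG; apply/genS/imsetS. Qed.

Lemma mem_power_subgroup G x : x \in G -> x ^+ p \in power_subgroup p G.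
Proof. by move=> Gx; apply/mem_gen/imsetP; exists x. Qed.

Lemma power_subgroup_sub G : power_subgroup p G \subset G.
Proof. by rewrite gen_subG; apply/subsetP => _ /imsetP[x Gx ->]; rewrite groupX. Qed.

Definition comm_central G : Prop := forall x y z, x \in G -> y \in G -> z \in G ->
  commute z [~ x, y] /\ [~ x, y] ^+ p = 1.

(** In (x y)^p the commutator appears to the power p (p - 1) / 2, a multiple of p because p is
    odd. *)
Lemma comm_central_expM G : odd p -> comm_central G ->
  {in G &, {morph (fun x => x ^+ p) : x y / x * y}}.
Proof.
move=> p_odd cG x y Gx Gy /=.
have [cx cp] := cG y x x Gy Gx Gx; have [cy _] := cG y x y Gy Gx Gy.
by rewrite expMg_Rmul // bin2odd // expgM cp expg1n mulg1.
Qed.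

Lemma comm_central_powersE G : odd p -> comm_central G ->
  power_subgroup p G = [set x ^+ p | x in G].
Proof.
move=> p_odd /(comm_central_expM p_odd) pM; rewrite /power_subgroup gen_set_id //.
have -> : [set x ^+ p | x in G] = Morphism pM @* G by rewrite morphimE setIid.
exact: groupP.
Qed.

Lemma comm_central_power_commute G x y : comm_central G -> x \in G -> y \in G ->
  commute (x ^+ p) y.
Proof.
move=> cG Gx Gy; apply/commgP; rewrite commXg;
  first by have [_ ->] := cG x y x Gx Gy Gx.
by have [] := cG x y x Gx Gy Gx.
Qed.

(* By induction, elements of K^p are p-th powers x^p with x in K; so, for g in G,
   [x, g] is such a power, it commutes with x and [x^p, g] = [x, g]^p = 1. *)
Lemma chain_comm_central G s : odd p -> (forall x, x \in G -> x ^+ (p ^ 2) = 1) ->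
  powerfully_abelian_chain p G s -> last G s = 1%G -> comm_central G.
Proof.
move=> p_odd; elim: s G => [|K s IHs] G G_exp /=.
  move=> _ -> x y z /set1P-> /set1P-> /set1P->.
  by rewrite comm1g expg1n; split.
case/andP=> /andP[sKG sGK] chK lastK; have sKG' := subsetP sKG.
have cK : comm_central K by apply: IHs => // x /sKG'; apply: G_exp.
have PE := comm_central_powersE p_odd cK.
have RG x y : x \in G -> y \in G -> [~ x, y] \in [set x ^+ p | x in K].
  by move=> Gx Gy; rewrite -PE (subsetP sGK) ?mem_commg.
have Rp x y : x \in G -> y \in G -> [~ x, y] ^+ p = 1.
  by move=> Gx Gy; have /imsetP[z /sKG' Kz ->] := RG x y Gx Gy; rewrite -expgM G_exp.
move=> x y z Gx Gy Gz; split; last exact: Rp.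
have /imsetP[w Kw ->] := RG x y Gx Gy; have Gw := sKG' w Kw.
apply/commute_sym/commgP; rewrite commXg ?Rp //.
have /imsetP[v Kv ->] := RG w z Gw Gz.
by apply: commute_sym; apply: (comm_central_power_commute cK).
Qed.

End PowerStructure.

Section Abelem.
Variables (p : nat) (gT : finGroupType).
Implicit Types G H K : {group gT}.

Lemma card_abelem_gen (Y : {set gT}) :
  prime p -> p.-abelem <<Y>> -> #|<<Y>>| <= p ^ #|Y|.
Proof.
move=> p_pr abY; have [pY cYY _] := and3P abY.
rewrite (card_pgroup pY) leq_exp2l ?prime_gt1 //.
by rewrite -(rank_abelem abY) -grank_abelian // grank_min.
Qed.
End Abelem.

(** * Generating sequences adapted to a powerfully abelian chain *)

Section Adapted.
Variables (p : nat) (gT : finGroupType).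
Implicit Types (G H K : {group gT}) (xs : seq gT).

Fixpoint adapted xs : bool :=
  if xs is x :: s then
    all (fun y => [~ x, y] \in <<[set z ^+ p | z in s]>>) s && adapted s
  else true.

Lemma adapted_nth xs i j : adapted xs -> i < j < size xs ->
  [~ nth 1 xs i, nth 1 xs j]
    \in <<[set nth 1 xs k ^+ p | k : 'I_(size xs) & i < k]>>.
Proof.
elim: xs i j => [|x s IHs] [|i] [|j] //=; first by rewrite andbF.
  case/andP=> /allP sx _ ltjs; apply: subsetP (sx _ (mem_nth 1 ltjs)).
  apply: genS; apply/subsetP=> _ /imsetP[z /(nthP 1)[k ltks <-] ->].
  by apply/imsetP; exists (lift ord0 (Ordinal ltks)); rewrite ?inE.
move=> /andP[_ ads] lt_ij; apply: subsetP (IHs i j ads lt_ij).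
apply: genS; apply/subsetP=> _ /imsetP[k + ->]; rewrite inE => ltik.
by apply/imsetP; exists (lift ord0 k); rewrite ?inE.
Qed.

Variables (G : {group gT}) (p_pr : prime p) (p_odd : odd p).
Hypotheses (cG : comm_central p G) (G_exp : forall x, x \in G -> x ^+ (p ^ 2) = 1).
Hypothesis RG : [~: G, G] \subset power_subgroup p G.

Local Notation P := (power_subgroup p G).

Lemma power_subgroup_expg x : x \in P -> x ^+ p = 1.
Proof.
by rewrite comm_central_powersE // => /imsetP[y Gy ->]; rewrite -expgM G_exp.
Qed.

Lemma power_subgroup_center : P \subset 'Z(G).
Proof.
rewrite subsetI power_subgroup_sub comm_central_powersE //.
apply/subsetP=> _ /imsetP[x Gx ->]; apply/centP=> y Gy.
exact: comm_central_power_commute cG Gx Gy.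
Qed.

Lemma power_subgroup_abelem : p.-abelem P.
Proof.
apply/abelemP=> //; split; last by move=> x; apply: power_subgroup_expg.
by apply: abelianS power_subgroup_center (center_abelian G).
Qed.

(** When P contains [G, G], G / P is elementary abelian and this is the preimage of the F_p-span of
    [xs]. *)
Definition span_powers xs := <<[set x in xs]>> <*> P.

Lemma span_powers_sub xs : {subset xs <= G} -> span_powers xs \subset G.
Proof.
move=> sxG; rewrite join_subG gen_subG power_subgroup_sub andbT.
by apply/subsetP=> x; rewrite inE; apply: sxG.
Qed.

Lemma span_powers_cons x xs :
  span_powers (x :: xs) = <[x]> <*> span_powers xs.
Proof.
by rewrite /span_powers joingA set_cons [<[x]> <*> _]joing_idl joing_idr.
Qed.

Lemma card_span_powers_cons x xs : {subset x :: xs <= G} -> x \notin span_powers xs ->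
  #|span_powers (x :: xs)| = (p * #|span_powers xs|)%N.
Proof.
move=> sxG Lx; have Gx : x \in G by apply: sxG; rewrite mem_head.
have sL : span_powers xs \subset G.
  by apply: span_powers_sub => z zxs; apply: sxG; rewrite inE zxs orbT.
have nL : span_powers xs <| G.
  rewrite /normal sL -commg_subl (subset_trans (commSg _ sL)) //.
  by rewrite (subset_trans RG) // joing_subr.
have nLx : x \in 'N(span_powers xs) by apply: subsetP Gx; apply: normal_norm.
rewrite span_powers_cons -(Lagrange (joing_subr <[x]> _)) mulnC; congr (_ * _)%N.
rewrite -card_quotient; last by rewrite join_subG cycle_subG nLx normG.
rewrite quotientYidr ?cycle_subG // quotient_cycle // -orderE.
apply: nt_prime_order => //; last first.
  by apply: contra Lx => /eqP/coset_idr->.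
rewrite -morphX //; apply: coset_id.
by rewrite mem_gen // inE mem_power_subgroup ?orbT.
Qed.

(** The map x |-> x^p is a homomorphism that kills P, so only the powers of the members of [xs]
    survive. *)
Lemma power_span_powers K xs : {subset xs <= G} -> K \subset span_powers xs ->
  power_subgroup p K \subset <<[set z ^+ p | z in xs]>>.
Proof.
move=> sxG sK; rewrite gen_subG; apply/subsetP=> _ /imsetP[x /(subsetP sK) Kx ->].
have pM := comm_central_expM p_odd cG.
have sS : [set x in xs] :|: P \subset G.
  rewrite subUset power_subgroup_sub andbT.
  by apply/subsetP=> z; rewrite inE; apply: sxG.
move: Kx; rewrite /span_powers joing_idl => Kx.
have Gx : x \in G by apply: subsetP Kx; rewrite gen_subG.
have: Morphism pM x \in Morphism pM @* <<[set x in xs] :|: P>> by apply: mem_morphim.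
rewrite morphim_gen //; apply: subsetP; rewrite gen_subG.
apply/subsetP=> _ /morphimP[y Gy + ->]; rewrite !inE => /orP[yxs | yP] /=.
  by apply: mem_gen; apply/imsetP; exists y.
by rewrite power_subgroup_expg ?group1.
Qed.

(** The cardinality makes [xs] independent modulo P; thus [xs] gives a basis of H P / P. *)
Definition adapted_to H xs : Prop := [/\ {subset xs <= H}, adapted xs,
  H \subset span_powers xs & #|span_powers xs| = (p ^ size xs * #|P|)%N].

(** Elements of H outside the span are prepended one at a time. The list stays adapted because
    [H, H] lies in K^p, which is spanned by the powers of the members already listed. *)
Lemma adapted_extend H K xs : H \subset G -> [~: H, H] \subset power_subgroup p K ->
  {subset xs <= H} -> adapted xs -> K \subset span_powers xs ->
  #|span_powers xs| = (p ^ size xs * #|P|)%N ->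
  exists xs', adapted_to H xs'.
Proof.
move=> sHG RK; have sHG' := subsetP sHG.
have [m] := ubnP (#|G| - #|span_powers xs|).
elim: m xs => // m IHm xs ltm sxH axs sKx card_x.
have [sHx | /subsetPn[x Hx Lx]] := boolP (H \subset span_powers xs).
  by exists xs.
have sxG : {subset x :: xs <= G}.
  by move=> z; rewrite inE => /predU1P[-> | /sxH]; apply: sHG'.
have card' := card_span_powers_cons sxG Lx.
have lecard := subset_leq_card (span_powers_sub sxG).
apply: (IHm (x :: xs)) => [||||/=].
- rewrite -ltnS (leq_trans _ ltm) // ltnS ltn_sub2l //.
    apply: leq_trans lecard; rewrite card' ltn_Pmull ?prime_gt1 ?cardG_gt0 //.
  by rewrite card' ltn_Pmull ?prime_gt1 ?cardG_gt0.
- by move=> z; rewrite inE => /predU1P[-> | /sxH].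
- rewrite /= axs andbT; apply/allP=> y xy.
  have sxG' : {subset xs <= G} by move=> z /sxH/sHG'.
  apply: (subsetP (power_span_powers sxG' sKx)).
  by apply: (subsetP RK); apply: mem_commg Hx (sxH _ xy).
- by rewrite span_powers_cons (subset_trans sKx) ?joing_subr.
by rewrite card' card_x expnS mulnA.
Qed.

(** The list is built from the bottom of the chain: it is empty for 1, and each larger term extends
    the list of the next one. *)
Lemma chain_adapted H s : H \subset G -> powerfully_abelian_chain p H s ->
  last H s = 1%G -> exists xs, adapted_to H xs.
Proof.
elim: s H => [|K s IHs] H sHG /=.
  move=> _ ->; exists [::]; split=> //; first by rewrite sub1G.
  by rewrite /span_powers set_nil gen0 joing1G expn0 mul1n.
case/andP=> /andP[sKH RK] chK lastK.
have [xs [sxK axs sKx cx]] := IHs K (subset_trans sKH sHG) chK lastK.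
by apply: adapted_extend RK _ axs sKx cx => // x /sxK; apply: subsetP.
Qed.

End Adapted.

Lemma abelem_gen (p : nat) (gT : finGroupType) (Y : {set gT}) : prime p ->
  abelian Y -> {in Y, forall y, y ^+ p = 1} -> p.-abelem <<Y>>.
Proof.
move=> p_pr cY Yp; have cYY : abelian <<Y>> by rewrite abelian_gen.
apply/abelemP=> //; split=> // y.
have : <<Y>> \subset Group (group_Ldiv p cYY).
  rewrite gen_subG; apply/subsetP=> z Yz.
  by apply/LdivP; split; [apply: mem_gen | apply: Yp].
by move/subsetP/(_ y)=> /= sub /sub /LdivP[].
Qed.

Lemma isog_of_card_morphim (aT rT : finGroupType) (D G : {group aT})
  (f : {morphism D >-> rT}) : G \subset D -> #|f @* G| = #|G| -> G \isog f @* G.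
Proof.
move=> sGD cfG; have im : restrm sGD f @* G = f @* G by rewrite morphim_restrm setIid.
by rewrite -im; apply: sub_isog => //; rewrite -card_im_injm im cfG.
Qed.

(* The subgroup of the direct product generated by the pairs of corresponding
   elements is too small to be anything but the graph of an isomorphism. *)
Lemma same_relations_isog (p d : nat) (gT rT : finGroupType)
  (G Z : {group gT}) (H : {group rT}) (theta : {morphism Z >-> rT})
  (x : 'I_d -> gT) (y : 'I_d -> rT) :
  prime p -> Z \subset 'Z(G) -> 'injm theta -> theta @* Z \subset 'Z(H) ->
  G :=: <<[set x i | i : 'I_d]>> <*> Z ->
  H :=: <<[set y i | i : 'I_d]>> <*> theta @* Z ->
  #|G| = (p ^ d * #|Z|)%N -> #|H| = (p ^ d * #|Z|)%N ->
  (forall i, x i ^+ p \in Z /\ theta (x i ^+ p) = y i ^+ p) ->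
  (forall i j, [~ x i, x j] \in Z /\ theta [~ x i, x j] = [~ y i, y j]) ->
  G \isog H.
Proof.
move=> p_pr sZ injt stZ defG defH cardG cardH xp xR.
pose D0 := [set (z, theta z) | z in Z].
have gD : group_set D0.
  apply/group_setP; split; first by apply/imsetP; exists 1; rewrite ?morph1.
  move=> _ _ /imsetP[u Zu ->] /imsetP[v Zv ->]; apply/imsetP.
  by exists (u * v); rewrite ?groupM ?morphM.
pose D := Group gD.
have cardD : #|D| = #|Z| by apply: card_in_imset => u v _ _ [].
have mD z : z \in Z -> (z, theta z) \in D by move=> Zz; apply/imsetP; exists z.
have Gx i : x i \in G.
  by rewrite defG (subsetP (joing_subl _ _)) // mem_gen //; apply/imsetP; exists i.
have Hy i : y i \in H.
  by rewrite defH (subsetP (joing_subl _ _)) // mem_gen //; apply/imsetP; exists i.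
pose Y := [set (x i, y i) | i : 'I_d].
have cD u v w : u \in G -> v \in H -> w \in D -> commute w (u, v).
  move=> Gu Hv /imsetP[z Zz ->]; have /setIP[_ /centP cz] := subsetP sZ z Zz.
  have /(subsetP stZ)/setIP[_ /centP ctz] := mem_morphim theta Zz Zz.
  by congr (_, _); [apply: cz | apply: ctz].
have nDY : Y \subset 'N(D).
  apply: subset_trans (cent_sub _); apply/subsetP=> _ /imsetP[i _ ->].
  by apply/centP=> w Dw; apply/commute_sym/cD.
have Ycoset i : (x i, y i) \in 'N(D) by rewrite (subsetP nDY) //; apply/imsetP;
  exists i.
(* By [xp] and [xR], the p-th powers and commutators of the pairs fall into the graph D of
   [theta]. *)
have abY : p.-abelem <<Y / D>>.
  apply: abelem_gen => //.
    apply/centsP=> _ /morphimP[_ _ /imsetP[i _ ->] ->] _ /morphimP[_ _ /imsetP[j _ ->]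
      ->].
    apply/commgP; rewrite -morphR //=; apply/eqP/coset_id.
    by have [Zij tij] := xR i j; have := mD _ Zij; rewrite tij.
  move=> _ /morphimP[_ _ /imsetP[i _ ->] ->]; rewrite -morphX //=; apply: coset_id.
  have [Zi ti] := xp i; have := mD _ Zi; rewrite ti.
  suff -> : (x i, y i) ^+ p = (x i ^+ p, y i ^+ p) by [].
  by elim: (p) => // k IHk; rewrite !expgS IHk.
pose C := <<Y>> <*> D.
(* Since D has index at most p^d in C, the projections of C onto G and onto H will have to be
   bijective. *)
have cardC : #|C| <= #|G|.
  rewrite -(Lagrange (joing_subr <<Y>> D)) cardD cardG mulnC leq_mul2r; apply/orP;
    right.
  have nDY' : <<Y>> \subset 'N(D) by rewrite gen_subG.
  rewrite -card_quotient ?join_subG ?nDY' ?normG // quotientYidr // quotient_gen //.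
  apply: leq_trans (card_abelem_gen p_pr abY) _; rewrite leq_exp2l ?prime_gt1 //.
  apply: leq_trans (leq_morphim _ _) _; apply: leq_trans (leq_imset_card _ _) _.
  by rewrite card_ord.
have Cx i : (x i, y i) \in C.
  by rewrite (subsetP (joing_subl _ _)) // mem_gen //; apply/imsetP; exists i.
have CD z : z \in Z -> (z, theta z) \in C.
  by move=> Zz; rewrite (subsetP (joing_subr _ _)) // mD.
have fstC : [morphism of fun u : gT * rT => u.1] @* C = G.
  apply/eqP; rewrite eq_sym eqEcard (leq_trans (leq_morphim _ _) cardC) andbT.
  rewrite defG join_subG gen_subG; apply/andP; split.
    by apply/subsetP=> _ /imsetP[i _ ->]; apply/imsetP; exists (x i, y i);
      rewrite ?inE ?Cx.
  apply/subsetP=> z Zz; apply/imsetP; exists (z, theta z) => //.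
  by rewrite !inE CD.
have sndC : [morphism of fun u : gT * rT => u.2] @* C = H.
  apply/eqP; rewrite eq_sym eqEcard cardH -cardG (leq_trans (leq_morphim _ _) cardC)
    andbT.
  rewrite defH join_subG gen_subG; apply/andP; split.
    by apply/subsetP=> _ /imsetP[i _ ->]; apply/imsetP; exists (x i, y i);
      rewrite ?inE ?Cx.
  apply/subsetP=> _ /morphimP[z _ Zz ->]; apply/imsetP; exists (z, theta z) => //.
  by rewrite !inE CD.
have card1 : #|C| = #|G|.
  by apply/eqP; rewrite eqn_leq cardC -{1}fstC leq_morphim.
have iso1 : C \isog G.
  by rewrite -fstC; apply: isog_of_card_morphim; rewrite ?subsetT // fstC card1.
have iso2 : C \isog H.
  by rewrite -sndC; apply: isog_of_card_morphim;
    rewrite ?subsetT // sndC card1 cardH cardG.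
by apply: isog_trans iso2; rewrite isog_sym.
Qed.

Definition param_count (s d : nat) : nat := (\sum_(m < d) m * minn s m)%N.

Lemma card_ord_gt d i : #|[set k : 'I_d | i < k]| = d - i.+1.
Proof.
rewrite -sum1dep_card -[RHS]muln1 -sum_nat_const_nat.
by rewrite (big_nat_widenl _ 0) // big_mkord.
Qed.

(** * Codes: powers and commutators as linear data over F_p *)

Section Codes.
Variables (p s d : nat).
Local Notation W := 'rV['F_p]_s.

Definition tail_span (pi : {ffun 'I_d -> W}) (i : nat) : {set W} :=
  <<[set pi k | k : 'I_d & i < k]>>.

(* A code lists the powers of d generators and, for i < j, their commutators; the
   value at the other pairs is fixed, to count each system of commutators once. *)
Definition codes : {set {ffun 'I_d -> W} * {ffun 'I_d * 'I_d -> W}} :=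
  [set c | c.2 \in family (fun ij : 'I_d * 'I_d =>
    if ij.1 < ij.2 then tail_span c.1 ij.1 else [set 1])].

Hypothesis p_pr : prime p.

Lemma card_rV_Fp : #|[set: W]| = (p ^ s)%N.
Proof. by rewrite cardsT card_mx mul1n card_Fp. Qed.

Lemma card_tail_span pi i : #|tail_span pi i| <= p ^ minn s (d - i.+1).
Proof.
have abT : p.-abelem (tail_span pi i).
  by apply: abelemS (fin_Fp_lmod_abelem _ p_pr); apply: subsetT.
rewrite /minn; case: ifP => _; first by rewrite -card_rV_Fp subset_leq_card ?subsetT.
apply: leq_trans (card_abelem_gen p_pr abT) _; rewrite leq_exp2l ?prime_gt1 //.
by apply: leq_trans (leq_imset_card _ _) _; rewrite card_ord_gt.
Qed.

Lemma card_codes : #|codes| <= p ^ (d * s + param_count s d).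
Proof.
pose E (i j : 'I_d) := if i < j then minn s (d - i.+1) else 0.
have sumE : \sum_ij E ij.1 ij.2 = param_count s d.
  rewrite -(pair_bigA _ E) /=.
  (* Reversing the order of the generators turns both the number of j > i and the dimension bound d
     - 1 - i into the summation index. *)
  rewrite /param_count (reindex_inj rev_ord_inj) /=; apply: eq_bigr => i _.
  rewrite -big_mkcond /= sum_nat_cond_const.
  by rewrite card_ord_gt subnSK // subKn // ltnW.
rewrite expnD expnM.
have -> : ((p ^ d) ^ s)%N = #|{ffun 'I_d -> W}|.
  by rewrite card_ffun card_ord card_mx mul1n card_Fp // -!expnM mulnC.
pose fam (pi : {ffun 'I_d -> W}) := family (fun ij : 'I_d * 'I_d =>
  if ij.1 < ij.2 then tail_span pi ij.1 else [set 1]).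
have -> : #|codes| = \sum_pi #|fam pi|.
  rewrite -sum1dep_card.
  rewrite -(pair_big_dep xpredT (fun pi b => b \in fam pi) (fun _ _ => 1%N)) /=.
  by apply: eq_bigr => pi _; rewrite sum1_card.
rewrite -sum_nat_const leq_sum // => pi _; rewrite /fam card_family.
rewrite foldrE big_map big_enum /= -sumE expn_sum leq_prod // => ij _.
by rewrite /E; case: ifP => _; [apply: card_tail_span | rewrite cards1].
Qed.

Variable gT : finGroupType.

(** The coordinates [f] on G^p and the generators [x] are a matter of choice, so this is a relation
    and not a function of G. *)
Definition coded (G : {group gT})
    (c : {ffun 'I_d -> W} * {ffun 'I_d * 'I_d -> W}) : Prop :=
  exists (f : {morphism power_subgroup p G >-> W}) (x : 'I_d -> gT),
  [/\ 'injm f, f @* power_subgroup p G = [set: W],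
      G :=: <<[set x i | i : 'I_d]>> <*> power_subgroup p G,
      (forall i, c.1 i = f (x i ^+ p)) &
      forall i j : 'I_d, i < j -> c.2 (i, j) = f [~ x i, x j]].

End Codes.

Definition pow_central p (gT : finGroupType) (G : {group gT}) : Prop :=
  power_subgroup p G \subset 'Z(G) /\ [~: G, G] \subset power_subgroup p G.

(** Comparing the two coordinate systems identifies G^p with H^p and matches powers and commutators
    of the generators, so [same_relations_isog] applies. *)
Lemma coded_isog p s d (gT : finGroupType) (G H : {group gT})
  (c : {ffun 'I_d -> 'rV['F_p]_s} * {ffun 'I_d * 'I_d -> 'rV['F_p]_s}) :
  prime p -> pow_central p G -> pow_central p H ->
  #|G| = (p ^ (d + s))%N -> #|H| = (p ^ (d + s))%N -> coded G c -> coded H c ->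
    G \isog H.
Proof.
move=> p_pr [sPG RG] [sPH RH] cardG cardH [f [x [injf imf defG pif Rf]]].
case=> g [y [injg img defH pig Rg]].
pose theta0 z := invm injg (f z).
have fg z : f z \in g @* power_subgroup p H by rewrite img inE.
have thM : {in power_subgroup p G &, {morph theta0 : u v / u * v}}.
  by move=> u v Pu Pv; rewrite /theta0 morphM // morphM.
pose theta := Morphism thM.
have thE u v : u \in power_subgroup p G -> v \in power_subgroup p H -> f u = g v ->
  theta u = v.
  by move=> Pu Pv fuv; rewrite /= /theta0 fuv invmE.
have injt : 'injm theta.
  apply/injmP => u v Pu Pv /= tuv; apply: (injmP injf u v Pu Pv).
  exact: (injmP (injm_invm injg) _ _ (fg u) (fg v) tuv).
have cardP : #|power_subgroup p G| = (p ^ s)%N.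
  by rewrite -(card_rV_Fp s p_pr) -imf (card_injm injf (subxx _)).
have cardQ : #|power_subgroup p H| = (p ^ s)%N.
  by rewrite -(card_rV_Fp s p_pr) -img (card_injm injg (subxx _)).
have imt : theta @* power_subgroup p G = power_subgroup p H.
  apply/eqP; rewrite eqEcard; apply/andP; split.
    apply/subsetP=> _ /morphimP[u _ Pu ->] /=; rewrite /theta0.
    suff: invm injg (f u) \in invm injg @* (g @* power_subgroup p H) by rewrite im_invm.
    by apply: mem_morphim.
  by rewrite (card_injm injt (subxx _)) cardP cardQ.
have Gx i : x i \in G.
  by rewrite defG (subsetP (joing_subl _ _)) // mem_gen //; apply/imsetP; exists i.
have Hy i : y i \in H.
  by rewrite defH (subsetP (joing_subl _ _)) // mem_gen //; apply/imsetP; exists i.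
have RGx i j : [~ x i, x j] \in power_subgroup p G by rewrite (subsetP RG) ?mem_commg.
have RHy i j : [~ y i, y j] \in power_subgroup p H by rewrite (subsetP RH) ?mem_commg.
have Rlt (i j : 'I_d) : i < j -> theta [~ x i, x j] = [~ y i, y j].
  by move=> ltij; apply: thE => //; rewrite -Rf // -Rg.
apply: (same_relations_isog (x := x) (y := y) p_pr sPG injt) => //.
- by rewrite imt.
- by rewrite imt.
- by rewrite cardG cardP expnD.
- by rewrite cardH cardP expnD.
- move=> i; split; first exact: mem_power_subgroup.
  by apply: thE; last rewrite -pif -pig; try apply: mem_power_subgroup.
move=> i j; split=> //; case: (ltngtP i j) => [|ltji|/val_inj->]; first exact: Rlt.
  by rewrite -[LHS]invgK -morphV // invg_comm Rlt // invg_comm.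
by rewrite !commgg morph1.
Qed.

(** * Codes of powerfully solvable groups of exponent p^2 *)

Section Existence.
Variables (p : nat) (gT : finGroupType) (G : {group gT}).
Hypotheses (p_pr : prime p) (p_odd : odd p).
Hypotheses (G_exp : exponent G = (p ^ 2)%N) (G_ps : powerfully_solvable p G).

Let G_exp' x : x \in G -> x ^+ (p ^ 2) = 1.
Proof. by move=> Gx; apply/eqP; rewrite -order_dvdn -G_exp dvdn_exponent. Qed.

Lemma powerfully_solvable_commutator : [~: G, G] \subset power_subgroup p G.
Proof.
case: G_ps => -[|K t] /=; first by move=> _ ->; rewrite commG1 sub1G.
case/andP=> /andP[sKG RK] _ _; apply: subset_trans RK _.
exact: power_subgroupS.
Qed.

Lemma powerfully_solvable_comm_central : comm_central p G.
Proof. by case: G_ps => t cht lastt;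
  apply: chain_comm_central p_odd G_exp' cht lastt. Qed.

Lemma powerfully_solvable_pow_central : pow_central p G.
Proof.
split; last exact: powerfully_solvable_commutator.
exact: power_subgroup_center p_odd powerfully_solvable_comm_central.
Qed.

Lemma powerfully_solvable_coded s d :
  #|G| = (p ^ (d + s))%N -> #|power_subgroup p G| = (p ^ s)%N ->
  exists2 c : {ffun 'I_d -> 'rV['F_p]_s} * {ffun 'I_d * 'I_d -> 'rV['F_p]_s},
    c \in codes p s d & coded G c.
Proof.
move=> cardG cardP; set P := power_subgroup p G.
have RG := powerfully_solvable_commutator; have cG := powerfully_solvable_comm_central.
have abP := power_subgroup_abelem p_pr p_odd cG G_exp'.
have : P \isog [set: 'rV['F_p]_s].
  by rewrite (isog_abelem_card _ abP) fin_Fp_lmod_abelem // card_rV_Fp // cardP eqxx.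
case/isogP=> f injf imf.
have [t cht lastt] := G_ps.
have [xs [sxG axs sGx cardx]] :=
  chain_adapted p_pr p_odd cG G_exp' RG (subxx _) cht lastt.
have defG : G :=: span_powers p G xs.
  by apply/eqP; rewrite eqEsubset sGx span_powers_sub.
(* The independence of [xs] modulo P fixes its length, by comparing orders. *)
have sizex : size xs = d.
  apply/eqP; rewrite -(eqn_exp2l _ _ (prime_gt1 p_pr)) -(eqn_pmul2r (cardG_gt0 P)).
  by rewrite -cardx -defG cardG cardP expnD.
rewrite -{}sizex in cardG *.
pose x (i : 'I_(size xs)) := nth 1 xs i.
have Gx i : x i \in G by apply: sxG; apply: mem_nth.
have Px i : x i ^+ p \in P by apply: mem_power_subgroup.
pose pi := [ffun i => f (x i ^+ p)].
pose b := [ffun ij : 'I_(size xs) * 'I_(size xs) =>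
  if ij.1 < ij.2 then f [~ x ij.1, x ij.2] else 1].
exists (pi, b); last first.
  exists f, x; split=> //=; last 2 [by move=> i; rewrite ffunE].
  - have -> // : [set x i | i : 'I_(size xs)] = [set z in xs].
    apply/setP=> z; rewrite inE; apply/imsetP/(nthP 1) => [[i _ ->] | [i lti <-]].
      by exists i.
    by exists (Ordinal lti).
  by move=> i j ltij; rewrite ffunE ltij.
rewrite inE; apply/familyP=> -[i j] /=; rewrite ffunE /=; case: ifP => ltij;
  last by rewrite inE.
have sT : [set x k ^+ p | k : 'I_(size xs) & i < k] \subset P.
  by apply/subsetP=> _ /imsetP[k _ ->].
have Rij : [~ x i, x j] \in P by rewrite (subsetP RG) ?mem_commg.
have ltj : i < j < size xs by rewrite ltij ltn_ord.
have := mem_morphim f Rij (adapted_nth axs ltj).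
rewrite morphim_gen //; apply: subsetP; apply: genS.
apply/subsetP=> _ /morphimP[_ _ /imsetP[k ltik ->] ->].
by apply/imsetP; exists k; rewrite ?ffunE.
Qed.

End Existence.

End PowerfullySolvableGroups.

(** * Groups with prescribed structure constants *)

Local Open Scope ring_scope.

(** A biadditive form whose values lie in both of its radicals; this makes x + y + b(x, y)
    associative. *)
Record twist_form (V : finZmodType) := TwistForm {
  twist_fun :> V -> V -> V;
  twistDl : forall z, {morph twist_fun^~ z : x y / x + y};
  twistDr : forall z, {morph twist_fun z : x y / x + y};
  twist0l : forall x y z, twist_fun (twist_fun x y) z = 0;
  twist0r : forall x y z, twist_fun z (twist_fun x y) = 0 }.

(** A copy of V that remembers [b], so that each form carries its own group structure. *)
Definition twist (V : finZmodType) (b : twist_form V) : Type := V.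

Section Twist.
Variables (V : finZmodType) (b : twist_form V).

HB.instance Definition _ := Finite.on (twist b).

Lemma twist_fun0l z : b 0 z = 0.
Proof. by apply: (addrI (b 0 z)); rewrite -twistDl !addr0. Qed.
Lemma twist_fun0r z : b z 0 = 0.
Proof. by apply: (addrI (b z 0)); rewrite -twistDr !addr0. Qed.
Lemma twistNl x z : b (- x) z = - b x z.
Proof. by apply: (addrI (b x z)); rewrite -twistDl !subrr twist_fun0l. Qed.
Lemma twistNr x z : b z (- x) = - b z x.
Proof. by apply: (addrI (b z x)); rewrite -twistDr !subrr twist_fun0r. Qed.
Lemma twistMnr x z n : b z (x *+ n) = b z x *+ n.
Proof. by elim: n => [|n IHn]; rewrite ?twist_fun0r // !mulrS twistDr IHn. Qed.

Definition twist_mul (x y : twist b) : twist b := (x : V) + (y : V) + b x y.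
Definition twist_inv (x : twist b) : twist b := - (x : V) + b x x.

Lemma twist_mulA : associative twist_mul.
Proof.
move=> x y z; rewrite /twist_mul !twistDl !twistDr twist0l twist0r !addr0 !addrA.
set u : V := x; set v : V := y; set w : V := z.
by rewrite (addrAC _ (b v w)) (addrAC _ (b v w)) (addrAC _ w (b u v)).
Qed.
Lemma twist_mul1 : left_id (0 : V) twist_mul.
Proof. by move=> x; rewrite /twist_mul twist_fun0l add0r addr0. Qed.
Lemma twist_mulV : left_inverse (0 : V) twist_inv twist_mul.
Proof.
move=> x; rewrite /twist_mul /twist_inv twistDl twist0l addr0 twistNl.
by rewrite (addrAC (- (x : V))) addNr add0r subrr.
Qed.

HB.instance Definition _ :=
  Finite_isGroup.Build (twist b) twist_mulA twist_mul1 twist_mulV.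

Lemma twist_mulE (x y : twist b) : (x * y)%g = (x : V) + (y : V) + b x y.
Proof. by []. Qed.

Lemma twist_1E : (1%g : twist b) = (0 : V).
Proof. by []. Qed.

Lemma twist_expE (x : twist b) n : (x ^+ n)%g = (x : V) *+ n + b x x *+ 'C(n, 2).
Proof.
elim: n => [|n IHn]; first by rewrite expg0 addr0.
rewrite expgS IHn twist_mulE twistDr !twistMnr twist0r mul0rn addr0.
by rewrite binS bin1 mulrS mulrnDr -!addrA.
Qed.

Lemma twist_commE (x y : twist b) : [~ x, y]%g = b x y - b y x.
Proof.
apply: (mulgI (y * x)%g);
  rewrite -commgC !twist_mulE !twistDl !twistDr !twistNr !twist0r.
by rewrite !subrr !addr0 addrA addrAC addrK (addrC (x : V)).
Qed.

End Twist.

HB.instance Definition _ (U V : finZmodType) := GRing.Zmodule.on (U * V)%type.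

(** * The abelian group (Z/p^2)^s x F_p^t *)

Section Base.
Variable p : nat.
Hypothesis p_pr : prime p.
Local Notation Q := 'Z_(p ^ 2).
Local Notation F := 'F_p.

Definition zp2_red (x : Q) : F := (x : nat)%:R.
Definition zp2_lift (a : F) : Q := (a : nat)%:R.
Definition zp2_emb (a : F) : Q := (p * a)%:R.

Let p2_gt1 : (1 < p ^ 2)%N.
Proof. by rewrite -(exp1n 2) ltn_exp2r // prime_gt1. Qed.

Let val_Q n : (n%:R : Q) = (n %% p ^ 2)%N :> nat.
Proof. exact: val_Zp_nat. Qed.

Let val_F n : (n%:R : F) = (n %% p)%N :> nat.
Proof. exact: val_Fp_nat. Qed.

Let F_lt (a : F) : (a < p)%N.
Proof. by have := ltn_ord a; rewrite [X in (_ < X)%N -> _]Fp_cast. Qed.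

(** Reduction is defined on least representatives; any representative will do since p divides p^2,
    and additivity follows. *)
Lemma zp2_red_nat n : zp2_red n%:R = n%:R.
Proof.
apply: val_inj; rewrite /= /zp2_red val_Q !val_F modn_dvdm //.
by rewrite expnS dvdn_mulr.
Qed.

Lemma zp2_redD : {morph zp2_red : x y / x + y}.
Proof. by move=> x y; rewrite -(natr_Zp x) -(natr_Zp y) -natrD !zp2_red_nat natrD. Qed.

Lemma zp2_emb_nat n : zp2_emb n%:R = (p * n)%:R.
Proof. by apply: val_inj;
  rewrite /= /zp2_emb !val_Q val_F expnS expn1 -muln_modr modn_mod muln_modr. Qed.

Lemma zp2_embD : {morph zp2_emb : x y / x + y}.
Proof. by move=> x y;
  rewrite -(natr_Zp x) -(natr_Zp y) -natrD !zp2_emb_nat mulnDr natrD. Qed.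

Lemma zp2_redK : cancel zp2_lift zp2_red.
Proof. by move=> a; rewrite /zp2_lift zp2_red_nat natr_Zp. Qed.

Lemma zp2_emb_inj : injective zp2_emb.
Proof.
move=> a b /(congr1 val) /=; rewrite /zp2_emb !val_Q.
have lt (c : F) : (p * c < p ^ 2)%N by rewrite expnS expn1 ltn_pmul2l ?prime_gt0.
rewrite !modn_small ?lt // => /eqP; rewrite eqn_pmul2l ?prime_gt0 // => /eqP ab.
exact: val_inj.
Qed.

Lemma zp2_red_emb a : zp2_red (zp2_emb a) = 0.
Proof. by rewrite zp2_red_nat; apply: val_inj; rewrite /= val_F modnMr. Qed.

Lemma zp2_mulrn x : x *+ p = zp2_emb (zp2_red x).
Proof. by rewrite -{1}(natr_Zp x) -mulrnA mulnC -zp2_emb_nat. Qed.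

Variables s t : nat.

(* Coordinates are numbered with the t factors of order p first; [chi] reduces all
   of them mod p, and [iota_base] embeds F_p^s as the multiples of p. *)
Definition base : finZmodType := ('rV[Q]_s * 'rV[F]_t)%type : finZmodType.

Definition chi (v : base) : 'rV[F]_(t + s) := row_mx v.2 (map_mx zp2_red v.1).
Definition iota_base (w : 'rV[F]_s) : base := (map_mx zp2_emb w, 0).
Definition chi_lift (r : 'rV[F]_(t + s)) : base :=
  (map_mx zp2_lift (rsubmx r), lsubmx r).

Lemma iota_baseD : {morph iota_base : u v / u + v}.
Proof.
move=> u v; congr (_, _); last by rewrite addr0.
by apply/rowP=> i; rewrite !mxE zp2_embD.
Qed.

Lemma chiD : {morph chi : u v / u + v}.
Proof.
move=> u v; rewrite /chi add_row_mx; congr row_mx.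
by apply/rowP=> i; rewrite !mxE zp2_redD.
Qed.

Lemma chiDE u v i : chi (u + v) 0 i = chi u 0 i + chi v 0 i.
Proof. by rewrite chiD mxE. Qed.

Lemma chi_iota_base w : chi (iota_base w) = 0.
Proof.
rewrite -[RHS]row_mx0; congr row_mx.
by apply/rowP=> i; rewrite !mxE zp2_red_emb.
Qed.

Lemma chi_iota_baseE w i : chi (iota_base w) 0 i = 0.
Proof. by rewrite chi_iota_base mxE. Qed.

Lemma iota_base_inj : injective iota_base.
Proof.
move=> u v [] /rowP uv; apply/rowP=> i.
by have := uv i; rewrite !mxE => /zp2_emb_inj.
Qed.

Lemma chi_liftK : cancel chi_lift chi.
Proof.
move=> r; rewrite /chi /chi_lift /= -[RHS]hsubmxK; congr row_mx.
by apply/rowP=> i; rewrite !mxE zp2_redK.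
Qed.

Lemma base_mulrn v : v *+ p = iota_base (rsubmx (chi v)).
Proof.
have -> : v *+ p = (v.1 *+ p, v.2 *+ p).
  have E n : v *+ n = (v.1 *+ n, v.2 *+ n) by elim: n => // n IHn; rewrite !mulrS IHn.
  exact: E.
congr (_, _); apply/rowP=> i; rewrite ?row_mxKr mulmxnE !mxE ?zp2_mulrn //.
by rewrite -mulr_natr pchar_Fp_0 // mulr0.
Qed.

Lemma card_base : #|base| = (p ^ (s + (t + s)))%N.
Proof.
rewrite card_prod !card_mx !mul1n card_Fp // card_ord Zp_cast //.
by rewrite -expnM -expnD mul2n -addnn -addnA (addnC s t).
Qed.

End Base.

(** * Twisted groups with given commutator coefficients *)

Section Family.
Variables p s t : nat.
Hypothesis p_pr : prime p.
Local Notation F := 'F_p.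
Local Notation d := (t + s)%N.
Local Notation V := (base p s t).
Local Notation coefs := {ffun 'I_d * 'I_d * 'I_s -> F}.

Implicit Types g : coefs.

(* [g (i, j, l)] is the exponent of the p-th power of the generator of index t + l
   in the commutator of the generators of indices i < j. *)
Definition coef_row g (ij : 'I_d * 'I_d) : 'rV[F]_s := \row_l g (ij, l).

(** The form factors through [chi] and takes values in its kernel, which gives both radical
    conditions of [twist_form]. *)
Definition form_fun g (x y : V) : V :=
  iota_base t (\sum_(ij : 'I_d * 'I_d) (chi x 0 ij.1 * chi y 0 ij.2) *: coef_row g ij).

Lemma form_funDl g z : {morph (form_fun g)^~ z : x y / x + y}.
Proof.
move=> x y; rewrite /form_fun -iota_baseD // -big_split; congr (iota_base t _).
by apply: eq_bigr => ij _; rewrite chiDE // mulrDl scalerDl.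
Qed.

Lemma form_funDr g z : {morph form_fun g z : x y / x + y}.
Proof.
move=> x y; rewrite /form_fun -iota_baseD // -big_split; congr (iota_base t _).
by apply: eq_bigr => ij _; rewrite chiDE // mulrDr scalerDl.
Qed.

Lemma iota_base0 : iota_base t 0 = 0 :> V.
Proof. by apply: (addrI (iota_base t 0)); rewrite -iota_baseD // !addr0. Qed.

Lemma form_fun0l g x y z : form_fun g (form_fun g x y) z = 0.
Proof.
rewrite [LHS]/form_fun big1 ?iota_base0 // => ij _.
by rewrite chi_iota_baseE // mul0r scale0r.
Qed.

Lemma form_fun0r g x y z : form_fun g z (form_fun g x y) = 0.
Proof.
rewrite [LHS]/form_fun big1 ?iota_base0 // => ij _.
by rewrite chi_iota_baseE // mulr0 scale0r.
Qed.

Definition form g : twist_form V :=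
  TwistForm (form_funDl g) (form_funDr g) (@form_fun0l g) (@form_fun0r g).

Local Notation gG g := [set: twist (form g)]%G.

Lemma card_twist g : #|gG g| = (p ^ (s + (t + s)))%N.
Proof. by rewrite cardsT card_base. Qed.

Definition gen_elt g (i : 'I_d) : twist (form g) := chi_lift (delta_mx 0 i).

Lemma formE g (x y : V) : form g x y = form_fun g x y. Proof. by []. Qed.

Lemma form_gen g i j :
  form g (gen_elt g i) (gen_elt g j) = iota_base t (coef_row g (i, j)).
Proof.
rewrite formE /form_fun (bigD1 (i, j)) //= big1 => [|[k l] /= ne].
  by rewrite !chi_liftK // !mxE !eqxx mulr1 scale1r addr0.
rewrite !chi_liftK // !mxE !eqxx /=; case: (k =P i) => [ki|];
  last by rewrite mul0r scale0r.
case: (l =P j) => [lj|]; last by rewrite mulr0 scale0r.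
by rewrite ki lj eqxx in ne.
Qed.

(** The twist does not affect p-th powers: p divides 'C(p, 2) and p kills the values of the form. *)
Lemma odd_p_exp g (x : twist (form g)) : odd p ->
  (x ^+ p)%g = iota_base t (rsubmx (chi (x : V))).
Proof.
move=> p_odd; rewrite twist_expE bin2odd // mulrnA base_mulrn //.
suff -> : form g x x *+ p = 0 by rewrite mul0rn addr0.
by rewrite base_mulrn // formE chi_iota_base // raddf0 iota_base0.
Qed.

Lemma iota_mulg g u v :
  ((iota_base t u : twist (form g)) * iota_base t v)%g = iota_base t (u + v).
Proof.
rewrite twist_mulE iota_baseD // formE /form_fun big1 ?iota_base0 ?addr0 // => ij _.
by rewrite chi_iota_baseE // mul0r scale0r.
Qed.

Lemma iota_expg g u n :
  ((iota_base t u : twist (form g)) ^+ n)%g = iota_base t (u *+ n).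
Proof.
elim: n => [|n IHn]; first by rewrite expg0 mulr0n iota_base0.
by rewrite expgS IHn iota_mulg mulrS.
Qed.

(** The p-th powers of the last s generators span the image of [iota_base], so a homomorphism is
    determined there by the images of these generators. *)
Lemma iota_prod g (w : 'rV[F]_s) : odd p ->
  (iota_base t w : twist (form g)) =
    (\prod_(l < s) (gen_elt g (rshift t l) ^+ p) ^+ (w 0 l))%g.
Proof.
move=> p_odd; rewrite [w in LHS]row_sum_delta.
have E : {morph (fun u => iota_base t u : twist (form g)) : u v / u + v >-> (u * v)%g}.
  by move=> u v; rewrite iota_mulg.
rewrite (big_morph _ E (iota_base0 : iota_base t 0 = 1%g :> twist (form g))).
apply: eq_bigr => l _; rewrite odd_p_exp // iota_expg chi_liftK //;
  congr (iota_base t _).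
by apply/rowP=> k; rewrite mulmxnE !mxE eqxx /= eq_rshift -[RHS]mulr_natr natr_Zp mulrC.
Qed.

(** The first condition keeps each pair of generators once; the second is adaptedness, as the
    generator whose p-th power occurs has index t + l > i. *)
Definition coef_supp : {set 'I_d * 'I_d * 'I_s} :=
  [set u : 'I_d * 'I_d * 'I_s | (u.1.1 < u.1.2)%N && (u.1.1 < t + u.2)%N].

Definition coef_set : {pred coefs} := pffun_on 0 (mem coef_supp) predT.

Lemma card_coef_set : #|coef_set| = (p ^ param_count s (t + s))%N.
Proof.
rewrite card_pffun_on [#|predT|]card_Fp //; congr (p ^ _)%N.
pose E (i j : 'I_d) (l : 'I_s) : nat := ((i < j) && (i < t + l))%N.
have sumb (T : finType) (P : pred T) : (\sum_x P x = #|[set x | P x]|)%N.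
  by rewrite -sum1dep_card [RHS]big_mkcond; apply: eq_bigr => x _; case: (P x).
rewrite -[LHS]sumb -(pair_bigA _ (fun ij l => E ij.1 ij.2 l)).
rewrite -(pair_bigA _ (fun i j => \sum_l E i j l))%N /=.
rewrite /param_count [RHS](reindex_inj rev_ord_inj) /=; apply: eq_bigr => i _.
have -> : (\sum_j \sum_l E i j l = \sum_(j < d) ((i < j) * \sum_(l < s) (i < t + l)))%N.
  by apply: eq_bigr => j _; rewrite big_distrr; apply: eq_bigr => l _; rewrite /= mulnb.
rewrite -big_distrl /=; congr (_ * _)%N; first by rewrite sumb card_ord_gt.
(* For i < t every l is allowed and the minimum is s; for i >= t only l > i - t remain, which are d
   - 1 - i in number. *)
rewrite sumb; have [ltit|leti] := ltnP i t.
  rewrite (minn_idPl _); last by lia.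
  by rewrite -[RHS]card_ord -cardsT; apply: eq_card => l; rewrite !inE; lia.
rewrite (minn_idPr _); last by lia.
have -> : (d - i.+1 = s - (i - t).+1)%N by have := ltn_ord i; lia.
by rewrite -card_ord_gt; apply: eq_card => l; rewrite !inE; lia.
Qed.

Lemma gen_comm g (i j : 'I_d) : g \in coef_set -> (i < j)%N ->
  [~ gen_elt g i, gen_elt g j]%g = iota_base t (coef_row g (i, j)).
Proof.
move=> /pffun_onP[/subsetP supp _] ltij; rewrite twist_commE !form_gen.
have -> : coef_row g (j, i) = 0.
  apply/rowP=> l; rewrite !mxE; apply: contraTeq ltij => nz.
  by have := supp (j, i, l) nz; rewrite !inE /= -leqNgt => /andP[/ltnW].
by rewrite iota_base0 subr0.
Qed.

Lemma morph_iota_base g (rT : finGroupType) (f : twist (form g) -> rT) (w : 'rV[F]_s) :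
  odd p -> {morph f : x y / (x * y)%g} ->
  f (iota_base t w) = (\prod_(l < s) (f (gen_elt g (rshift t l)) ^+ p) ^+ (w 0 l))%g.
Proof.
move=> p_odd fM; pose fm :=
  Morphism (in2W fM : {in [set: twist (form g)] &, {morph f : x y / (x * y)%g}}).
have fX x n : f (x ^+ n)%g = (f x ^+ n)%g by apply: (morphX fm); rewrite inE.
rewrite (congr1 f (iota_prod g w p_odd)) (big_morph _ fM (morph1 fm)).
by apply: eq_bigr => l _; rewrite !fX.
Qed.

(** Homomorphisms that agree on the generators agree on their p-th powers, hence on the image of
    [iota_base]. Comparing the images of commutators of generators, injectivity of [k] then gives
    equal coefficients. *)
Lemma coef_inj g h (rT : finGroupType)
  (f : twist (form g) -> rT) (k : twist (form h) -> rT) : odd p ->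
  g \in coef_set -> h \in coef_set ->
  {morph f : x y / (x * y)%g} -> {morph k : x y / (x * y)%g} -> injective k ->
  (forall i, f (gen_elt g i) = k (gen_elt h i)) -> g = h.
Proof.
move=> p_odd Cg Ch fM kM k_inj eq_gen.
pose fm :=
  Morphism (in2W fM : {in [set: twist (form g)] &, {morph f : x y / (x * y)%g}}).
pose km :=
  Morphism (in2W kM : {in [set: twist (form h)] &, {morph k : x y / (x * y)%g}}).
have fR x y : f [~ x, y]%g = [~ f x, f y]%g by apply: (morphR fm); rewrite inE.
have kR x y : k [~ x, y]%g = [~ k x, k y]%g by apply: (morphR km); rewrite inE.
have fgh w : f (iota_base t w) = k (iota_base t w).
  rewrite (morph_iota_base _ p_odd fM) (morph_iota_base _ p_odd kM).
  by apply: eq_bigr => l _; rewrite eq_gen.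
apply/ffunP=> -[[i j] l]; have [ltij|leji] := ltnP i j; last first.
  have Z c : c \in coef_set -> c (i, j, l) = 0.
    case/pffun_onP=> /subsetP supp _; apply: contraTeq leji => nz.
    by have := supp (i, j, l) nz; rewrite !inE /= -ltnNge => /andP[].
  by rewrite !Z.
have := congr2 (fun x y => [~ x, y]%g) (eq_gen i) (eq_gen j).
rewrite /= -fR -kR => E.
have : k (iota_base t (coef_row g (i, j))) = k (iota_base t (coef_row h (i, j))).
  by rewrite -fgh -(gen_comm Cg ltij) -(gen_comm Ch ltij).
by move/k_inj/(iota_base_inj p_pr)/rowP/(_ l); rewrite !mxE.
Qed.

End Family.

(** * The twisted groups are powerfully solvable of exponent p^2 *)

Section FamilyProps.
Variables p s t : nat.
Hypotheses (p_pr : prime p) (p_odd : odd p).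
Local Notation F := 'F_p.
Local Notation d := (t + s)%N.
Local Notation V := (base p s t).
Local Notation coefs := {ffun 'I_d * 'I_d * 'I_s -> F}.
Variable g : coefs.
Hypothesis Cg : g \in @coef_set p s t.
Local Notation T := (twist (form p_pr g)).

Lemma chi_mulg (x y : T) i : chi (x * y)%g 0 i = chi x 0 i + chi y 0 i.
Proof. by rewrite twist_mulE !chiDE // formE chi_iota_baseE // addr0. Qed.

(** The terms of the powerfully abelian chain: all of them contain the kernel of [chi], and step k
    removes the generator of index k. *)
Definition flag_set (k : nat) : {set T} :=
  [set v | [forall (i : 'I_d | (i < k)%N), chi (v : V) 0 i == 0]].

Lemma flagP k (v : T) :
  reflect (forall i : 'I_d, (i < k)%N -> chi (v : V) 0 i = 0) (v \in flag_set k).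
Proof.
by rewrite inE; apply: (iffP forall_inP) => H i /H; [move/eqP | move=> ->].
Qed.

Lemma flag_group_set k : group_set (flag_set k).
Proof.
apply/group_setP; split; first by apply/flagP => i _;
  rewrite twist_1E -(iota_base0 s t p_pr) chi_iota_baseE.
move=> x y /flagP Hx /flagP Hy; apply/flagP => i ltik.
by rewrite chi_mulg Hx // Hy // addr0.
Qed.

Definition flag k : {group T} := Group (flag_group_set k).

Lemma flag0 : flag 0 = [set: T]%G.
Proof. by apply/val_inj/setP => v; rewrite [RHS]inE; apply/flagP. Qed.

Lemma flagS k : flag k.+1 \subset flag k.
Proof. by apply/subsetP => v /flagP Hv; apply/flagP => i ltik; apply: Hv;
  apply: ltnW. Qed.

(** Only pairs with i >= k contribute, and the support condition i < t + l then forces t + l > k. *)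
Lemma form_row_flag k (x y : T) : x \in flag k -> y \in flag k ->
  exists2 w : 'rV[F]_s, form p_pr g x y = iota_base t w &
    forall l : 'I_s, (t + l < k.+1)%N -> w 0 l = 0.
Proof.
move=> /flagP Hx /flagP Hy; rewrite formE /form_fun; eexists => // l ltlk.
rewrite summxE big1 // => -[i j] _; rewrite [LHS]mxE [coef_row _ _ _ _]mxE /=.
have [/Hx-> | leki] := ltnP i k; first by rewrite !mul0r.
suff -> : g (i, j, l) = 0 by rewrite mulr0.
case/pffun_onP: Cg => /subsetP supp _; apply: contraTeq leki => nz.
by have := supp (i, j, l) nz; rewrite !inE /=; lia.
Qed.

Lemma flag_comm k (x y : T) : x \in flag k -> y \in flag k ->
  [~ x, y]%g \in power_subgroup p (flag k.+1).
Proof.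
move=> Hx Hy; have [w Ew w0] := form_row_flag Hx Hy;
  have [u Eu u0] := form_row_flag Hy Hx.
(* The root is a lift of the coordinates of the commutator; they vanish for t + l <= k, so it lies
   in [flag k.+1]. *)
have -> : [~ x, y]%g = ((chi_lift (row_mx 0 (w - u)) : T) ^+ p)%g.
  rewrite odd_p_exp // chi_liftK // row_mxKr twist_commE Ew Eu; apply/eqP.
  by rewrite subr_eq -iota_baseD // subrK.
apply/mem_power_subgroup/flagP => i; rewrite chi_liftK //.
case: (split_ordP i) => l ->; first by rewrite row_mxEl mxE.
by rewrite row_mxEr /= => ltlk; rewrite !mxE w0 // u0 // subrr.
Qed.

Lemma flag_last : [~: flag d, flag d]%g = 1%g.
Proof.
apply/commG1P/centsP => x Hx y Hy; apply/commgP.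
have z (u v : T) : u \in flag d -> v \in flag d -> form p_pr g u v = 0.
  move=> Hu Hv; have [w -> w0] := form_row_flag Hu Hv.
  suff -> : w = 0 by rewrite iota_base0.
  by apply/rowP => l; rewrite mxE w0 // ltnS leq_add2l ltnW.
by rewrite twist_commE z // z // subrr.
Qed.

Lemma twist_powerfully_solvable : powerfully_solvable p [set: T]%G.
Proof.
rewrite -flag0.
suff main m k : d = (k + m)%N -> powerfully_solvable p (flag k) by exact: (main d).
elim: m k => [|m IHm] k Ek.
  (* The last flag is the kernel of [chi]; it is abelian but in general not trivial, so the chain
     needs 1 as one more term. *)
  exists [:: 1%G] => //; rewrite addn0 in Ek; rewrite -Ek.
  by apply/andP; split=> //; apply/andP; split;
    [apply: sub1G | rewrite flag_last sub1G].
have [r chr lastr] := IHm k.+1 (etrans Ek (esym (addSnnS k m))).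
exists (flag k.+1 :: r) => //=; rewrite chr flagS /= andbT.
by rewrite gen_subG; apply/subsetP => _ /imset2P[x y Hx Hy ->]; apply: flag_comm.
Qed.

Lemma twist_exponent : (0 < s)%N -> exponent [set: T] = (p ^ 2)%N.
Proof.
move=> s_gt0.
have : (exponent [set: T] %| p ^ 2)%N.
  apply/exponentP => x _; rewrite -mulnn expgM !odd_p_exp // chi_iota_base //.
  by rewrite raddf0 iota_base0.
case/(dvdn_pfactor _ _ p_pr) => k lek2 Ek.
have : ~~ (exponent [set: T] %| p)%N.
  apply/exponentP => /(_ (gen_elt p_pr g (rshift t (Ordinal s_gt0))) (in_setT _)).
  rewrite odd_p_exp // chi_liftK // => E.
  have /(iota_base_inj p_pr)/rowP/(_ (Ordinal s_gt0)) :=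
    etrans E (esym (iota_base0 s t p_pr)).
  rewrite !mxE !eqxx => /eqP.
  by rewrite oner_eq0.
rewrite Ek => ndvd; congr (p ^ _)%N; case: k lek2 Ek ndvd => [|[|[|k]]] //= _ _.
  by rewrite dvd1n.
by rewrite expn1 dvdnn.
Qed.

End FamilyProps.

(** By [coef_inj], [g] is recovered from the images of the d generators under a chosen isomorphism,
    a d-tuple of elements of H. *)
Lemma card_fibre p s t (p_pr : prime p) (rT : finGroupType) (H : {group rT}) : odd p ->
  (#|[set g in @coef_set p s t | [set: twist (form p_pr g)]%G \isog H]|
     <= #|H| ^ (t + s))%N.
Proof.
move=> p_odd; set D := [set g in _ | _].
(* The type of the twisted group varies with [g], so the isomorphisms are stored as functions on the
   common carrier [base p s t]. *)
have fP g : exists f : {ffun base p s t -> rT}, g \in D ->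
  [/\ {morph (f : twist (form p_pr g) -> rT) : x y / (x * y)%g},
      injective f & forall x, f x \in H].
  case Dg: (g \in D); last by exists [ffun=> 1%g].
  move: Dg; rewrite inE => /andP[_ /isogP[f injf imf]].
  exists [ffun x : base p s t => f x] => _; split=> [x y|x y|x].
  - by rewrite !ffunE morphM ?inE.
  - by rewrite !ffunE => /(injmP injf) -> //; rewrite inE.
  by rewrite ffunE -imf mem_morphim ?inE.
pose f g := sval (cid (fP g)).
have fE g : g \in D -> _ := svalP (cid (fP g)).
pose Phi g := [ffun i => f g (gen_elt p_pr g i)].
have Phi_inj : {in D &, injective Phi}.
  move=> g h Dg Dh /ffunP eqP; have [fgM _ _] := fE g Dg;
    have [fhM fh_inj _] := fE h Dh.
  move: Dg Dh; rewrite !inE => /andP[Cg _] /andP[Ch _].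
  apply: (coef_inj p_odd Cg Ch fgM fhM fh_inj) => i.
  by have := eqP i; rewrite !ffunE.
have <- : #|@ffun_on_mem (ordinal (t + s)) rT (mem H)| = (#|H| ^ (t + s))%N.
  by rewrite card_ffun_on card_ord.
rewrite -(card_in_imset Phi_inj); apply/subset_leq_card/subsetP => _ /imsetP[g Dg ->];
  apply/ffun_onP => i.
by rewrite ffunE; have [_ _] := fE g Dg; apply.
Qed.

(** * Counting isomorphism classes *)

Section Classes.
Local Open Scope nat_scope.
Local Open Scope group_scope.

Lemma morphim_power_subgroup p (aT rT : finGroupType) (D K : {group aT})
    (f : {morphism D >-> rT}) : K \subset D ->
  f @* power_subgroup p K = power_subgroup p (f @* K).
Proof.
move=> sKD; have sK := subsetP sKD; rewrite /power_subgroup morphim_gen; last first.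
  by apply/subsetP=> _ /imsetP[x Kx ->]; rewrite groupX ?sK.
congr <<_>>; apply/setP=> y;
  apply/morphimP/imsetP => [[_ _ /imsetP[x Kx ->] ->] | [_ /morphimP[x Dx Kx ->] ->]].
  by exists (f x); rewrite ?morphX ?mem_morphim ?sK.
by exists (x ^+ p); rewrite ?groupX ?morphX //; apply/imsetP; exists x.
Qed.

Lemma isog_powerfully_solvable p (aT rT : finGroupType)
    (G : {group aT}) (H : {group rT}) :
  G \isog H -> powerfully_solvable p G -> powerfully_solvable p H.
Proof.
case/isogP=> f injf imf [s chs lasts].
have -> : H = (f @* G)%G by apply: val_inj; rewrite /= imf.
suff main (K : {group aT}) : K \subset G -> powerfully_abelian_chain p K s ->
    last K s = 1%G -> powerfully_solvable p (f @* K)%G by exact: main lasts.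
elim: s K {chs lasts} => [|L s IHs] K sKG /=; first by move=> _ ->; exists [::] => //;
  apply/val_inj/morphim1.
case/andP=> /andP[sLK RK] chL lastL; have sLG := subset_trans sLK sKG.
have [r chr lastr] := IHs L sLG chL lastL; exists ((f @* L)%G :: r) => //=.
rewrite /powerfully_abelian_chain /= in chr *; rewrite chr morphimS //= andbT.
by rewrite -morphimR // -morphim_power_subgroup // morphimS.
Qed.

Lemma ex_perm_isog (gT : finGroupType) (G : {group gT}) N : #|G| = N ->
  exists H : {group 'S_N}, G \isog H.
Proof. by move=> <-; have [H isoGH _] := cayley_isog G; exists H. Qed.

Lemma leq_card_rel (A B : finType) (X : {set A}) (Y : {set B}) (r : A -> B -> Prop) :
  (forall x, x \in X -> exists2 y, y \in Y & r x y) ->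
  (forall x x' y, x \in X -> x' \in X -> r x y -> r x' y -> x = x') ->
  #|X| <= #|Y|.
Proof.
move=> r_ex r_inj.
(* Options provide a default value outside X, as B may be empty. *)
have ex x : exists o, x \in X -> exists2 y, y \in Y & o = Some y /\ r x y.
  have [Xx | nXx] := boolP (x \in X); last by exists None.
  by have [y Yy rxy] := r_ex x Xx; exists (Some y) => _; exists y.
have [f fP] := choice ex.
have f_inj : {in X &, injective f}.
  move=> x x' Xx Xx' eqf; have [y _ [fx rx]] := fP x Xx;
    have [y' _ [fx' rx']] := fP x' Xx'.
  by apply: (r_inj x x' y); rewrite // -[y](_ : y' = y) //; move: eqf;
    rewrite fx fx' => -[].
have someI : injective (@Some B) by move=> y z [].
rewrite -(card_in_imset f_inj) -(card_imset _ someI).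
apply/subset_leq_card/subsetP => _ /imsetP[x Xx ->].
by have [y Yy [-> _]] := fP x Xx; apply: imset_f.
Qed.

(** * Upper and lower bounds for the number of classes *)

Section Count.
Variables (p n : nat).
Hypotheses (p_pr : prime p) (p_odd : odd p).

Definition ps_groups : {set {group 'S_(p ^ n)}} :=
  [set G : {group 'S_(p ^ n)} | (#|G| == p ^ n)%N &&
    `[< exponent G = (p ^ 2)%N /\ powerfully_solvable p G >]].

Definition ps_class (G : {group 'S_(p ^ n)}) : {set {group 'S_(p ^ n)}} :=
  [set H in ps_groups | G \isog H].

Lemma num_powerfully_solvableE : num_powerfully_solvable p n = #|ps_class @: ps_groups|.
Proof. by []. Qed.

Lemma eq_ps_class (G H : {group 'S_(p ^ n)}) : G \isog H -> ps_class G = ps_class H.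
Proof.
move=> isoGH; apply/setP=> K; rewrite !inE; congr (_ && _).
by apply/idP/idP; apply: isog_trans; rewrite // isog_sym.
Qed.

Lemma ps_groupsP (G : {group 'S_(p ^ n)}) :
  reflect [/\ #|G| = (p ^ n)%N, exponent G = (p ^ 2)%N & powerfully_solvable p G]
    (G \in ps_groups).
Proof.
rewrite inE; apply: (iffP andP) => [[/eqP cG /asboolP[eG pG]] | [cG eG pG]];
  first by split.
by split; [apply/eqP | apply/asboolP].
Qed.

(** The classes are sorted by |G^p| = p^s; those for a given s are at most as many as the codes with
    d = n - s. *)
Lemma num_upper : num_powerfully_solvable p n <=
  \sum_(s < n.+1) (p ^ ((n - s) * s + param_count s (n - s)))%N.
Proof.
rewrite num_powerfully_solvableE.
pose E s := [set G in ps_groups | #|power_subgroup p G| == (p ^ s)%N].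
have sub : ps_class @: ps_groups \subset \bigcup_(s < n.+1) ps_class @: E s.
  apply/subsetP=> _ /imsetP[G EG ->]; have [cG eG pG] := ps_groupsP G EG.
  have := cardSg (power_subgroup_sub p G); rewrite cG.
  case/(dvdn_pfactor _ _ p_pr) => s lesn cP; have ltsn : s < n.+1 by [].
  by apply/bigcupP; exists (Ordinal ltsn) => //; apply: imset_f; rewrite inE EG /= cP.
apply: leq_trans (subset_leq_card sub) _; elim/big_rec2: _ => [|s m X _ leX];
  first by rewrite cards0.
apply: leq_trans (leq_card_setU _ _) _; apply: leq_add leX.
apply: leq_trans (card_codes s (n - s) p_pr).
have pnE : (p ^ n = p ^ (n - s + s))%N by rewrite subnK // -ltnS.
apply: (leq_card_rel (r := fun B c =>
  exists2 G, G \in E s & B = ps_class G /\ coded G c)).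
  move=> _ /imsetP[G EsG ->]; have /setIdP[/ps_groupsP[cG eG pG] /eqP cP] := EsG.
  have [c cc Gc] := powerfully_solvable_coded p_pr p_odd eG pG (etrans cG pnE) cP.
  by exists c => //; exists G.
move=> _ _ c _ _ [G EG [-> Gc]] [H EH [-> Hc]]; apply: eq_ps_class.
case/setIdP: EG => /ps_groupsP[cG eG pG] _; case/setIdP: EH => /ps_groupsP[cH eH pH] _.
apply: coded_isog p_pr _ _ (etrans cG pnE) (etrans cH pnE) Gc Hc.
  exact: powerfully_solvable_pow_central eG pG.
exact: powerfully_solvable_pow_central eH pH.
Qed.

(** The coefficient systems are sorted by the class of their twisted group, and [card_fibre] bounds
    each fibre. *)
Lemma num_lower s t : 0 < s -> n = (s + (t + s))%N ->
  (p ^ param_count s (t + s) <= num_powerfully_solvable p n * (p ^ n) ^ (t + s))%N.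
Proof.
move=> s_gt0 nE; rewrite num_powerfully_solvableE -(card_coef_set s t p_pr).
have ex g : exists H : {group 'S_(p ^ n)}, g \in @coef_set p s t ->
    H \in ps_groups /\ [set: twist (form p_pr g)]%G \isog H.
  have cT : #|[set: twist (form p_pr g)]%G| = (p ^ n)%N.
    by apply: etrans (card_twist p_pr g) _; rewrite nE.
  have [H isoH] := ex_perm_isog cT.
  exists H => Cg; split=> //; apply/ps_groupsP; split.
  - by rewrite -(card_isog isoH).
  - by rewrite -(exponent_isog isoH); apply: twist_exponent.
  by apply: isog_powerfully_solvable isoH _; apply: twist_powerfully_solvable.
have [h hP] := choice ex.
rewrite -[X in (X <= _)%N]sum1_card (partition_big (fun g => ps_class (h g)) [in
  ps_class @: ps_groups]) /=; last first.
  by move=> g Cg; apply: imset_f; have [] := hP g Cg.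
rewrite -sum_nat_const; apply: leq_sum => B _.
have [[g0 /andP[C0 /eqP B0]] | none] :=
  pselect (exists g, (g \in @coef_set p s t) && (ps_class (h g) == B)); last first.
  by rewrite big1 // => g Cg; case: none; exists g.
have [/ps_groupsP[c0 _ _] iso0] := hP g0 C0.
rewrite sum1dep_card; have := @card_fibre p s t p_pr _ (h g0) p_odd; rewrite c0.
apply: leq_trans; apply/subset_leq_card/subsetP=> g; rewrite !inE => /andP[Cg /eqP Bg].
have [Eg isog] := hP g Cg; rewrite Cg /=; apply: isog_trans isog _.
have : h g \in ps_class (h g0) by rewrite B0 -Bg inE Eg isog_refl.
by rewrite inE => /andP[_]; rewrite isog_sym.
Qed.
End Count.

End Classes.

(** * Asymptotics *)

From mathcomp Require Import all_classical all_reals all_analysis.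
From mathcomp Require Import ring lra.

Import Order.TTheory GRing.Theory Num.Theory.
Import numFieldNormedType.Exports.

(** * Cubic estimates of the parameter count *)

Lemma param_countS s d : param_count s d.+1 = (param_count s d + d * minn s d)%N.
Proof. by rewrite /param_count big_ord_recr. Qed.

(** Every minimum is m here, so this is the sum of the squares m^2, which is d^3/3 up to O(d^2). *)
Lemma param_count_small s d : (d <= s)%N ->
  (3 * param_count s d <= d ^ 3 /\ d ^ 3 <= 3 * param_count s d + 3 * d ^ 2)%N.
Proof.
elim: d => [|d IHd] leds; first by rewrite /param_count big_ord0.
have [IH1 IH2] := IHd (ltnW leds); rewrite param_countS (minn_idPr (ltnW leds)).
by move: IH1 IH2; rewrite !expnS !expn0 !muln1; nia.
Qed.

(** From m = s on the summands are s m; the induction starts at d = s, where [param_count_small]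
    applies. *)
Lemma param_count_large s d : (s <= d)%N ->
  (6 * param_count s d + s ^ 3 <= 3 * s * d ^ 2 /\
   3 * s * d ^ 2 <= 6 * param_count s d + s ^ 3 + 6 * d ^ 2)%N.
Proof.
move=> /subnKC <-; elim: (d - s)%N => [|k IHk]; last first.
  case: IHk; rewrite addnS param_countS (minn_idPl (leq_addr k s)).
  by rewrite !expnS !expn0 !muln1; nia.
have [] := param_count_small (leqnn s); rewrite addn0 !expnS !expn0 !muln1; nia.
Qed.

Section Estimates.
Variable R : realType.
Let q : R := Num.sqrt 2.
Let alpha : R := (-1 + q) / 6.

Lemma sqrt2_bounds : q * q = 2 /\ 7/5 <= q <= 3/2.
Proof.
have qq : q * q = 2 by rewrite -expr2 sqr_sqrtr.
have q0 : 0 <= q by apply: sqrtr_ge0.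
by split=> //; apply/andP; split; nra.
Qed.

(* For fixed S + D, the maximum of S D^2/2 - S^3/6 is a double root of the difference. *)
Lemma alpha_identity (S D : R) :
  alpha * (S + D) ^+ 3 - (S * D ^+ 2 / 2 - S ^+ 3 / 6) =
  (S - (1 - q / 2) * (S + D)) ^+ 2 * ((1 + q) * (S + D) - S) / 3.
Proof.
have [qq _] := sqrt2_bounds; by rewrite /alpha; field: qq.
Qed.

Lemma param_count_upper (s d : nat) :
  (param_count s d)%:R <= alpha * (s + d)%:R ^+ 3 :> R.
Proof.
have [qq /andP[q_ge q_le]] := sqrt2_bounds; rewrite natrD.
have S0 : 0 <= s%:R :> R by []; have D0 : 0 <= d%:R :> R by [].
have [leds | /ltnW lesd] := leqP d s.
  have [+ _] := param_count_small leds; rewrite -(ler_nat R) natrX natrM => le1.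
  have le2 : (2 * d%:R) ^+ 3 <= (s%:R + d%:R) ^+ 3 :> R.
    by rewrite lerXn2r ?nnegrE //; move: leds; rewrite -(ler_nat R); lra.
  (* From q >= 7/5; it suffices since 8/15 exceeds the 1/3 of [param_count_small]. *)
  have a15 : 1 / 15 <= alpha by rewrite /alpha; lra.
  have N0 : 0 <= (s%:R + d%:R) ^+ 3 :> R by apply: exprn_ge0; lra.
  have D30 : 0 <= d%:R ^+ 3 :> R by apply: exprn_ge0.
  apply: le_trans (ler_wpM2r N0 a15); move: le2; rewrite exprMn; lra.
have [+ _] := param_count_large lesd.
rewrite -(ler_nat R) natrD (natrM _ 6) (natrX _ s 3) (natrM _ (3 * s)) (natrM _ 3)
  natrX => le1.
have := alpha_identity s%:R d%:R.
have : 0 <= (s%:R - (1 - q / 2) * (s%:R + d%:R)) ^+ 2 *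
            ((1 + q) * (s%:R + d%:R) - s%:R) / 3.
  apply: divr_ge0 => //; apply: mulr_ge0; first exact: sqr_ge0.
  have : 0 <= q * (s%:R + d%:R) by apply: mulr_ge0; lra.
  lra.
lra.
Qed.

(** With s within 1 of the maximiser, the square in [alpha_identity] is at most 1, so the loss is at
    most s + d. The error d^2 of [param_count_large] accounts for the other (s + d)^2. *)
Lemma param_count_lower (s d : nat) : (s <= d)%N ->
  s%:R <= (1 - q / 2) * (s + d)%:R < s.+1%:R ->
  alpha * (s + d)%:R ^+ 3 - 2 * (s + d)%:R ^+ 2 <= (param_count s d)%:R :> R.
Proof.
move=> lesd; rewrite natrD -(natr1 s) => /andP[sle slt].
have [qq /andP[q_ge q_le]] := sqrt2_bounds.
have S0 : 0 <= s%:R :> R by []; have D0 : 0 <= d%:R :> R by [].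
have [_] := param_count_large lesd.
rewrite -(ler_nat R) (natrM _ (3 * s)) (natrM _ 3) natrX 2!natrD !(natrM _ 6) !natrX =>
  le1.
have := alpha_identity s%:R d%:R.
set x := s%:R - (1 - q / 2) * (s%:R + d%:R); set y := (1 + q) * (s%:R + d%:R) - s%:R.
have x0 : x <= 0 by rewrite /x; lra.
have x1 : -1 <= x by rewrite /x; lra.
have x2 : x ^+ 2 <= 1 by rewrite expr2; nra.
have qD : 0 <= q * (s%:R + d%:R) by apply: mulr_ge0; lra.
have qD' : 0 <= (3 / 2 - q) * (s%:R + d%:R) by apply: mulr_ge0; lra.
have y0 : 0 <= y by rewrite /y; lra.
have yN : y <= 3 * (s%:R + d%:R) by rewrite /y; lra.
have xy : x ^+ 2 * y <= 3 * (s%:R + d%:R).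
  by apply: le_trans yN; rewrite ler_piMl.
have NN : s%:R + d%:R <= (s%:R + d%:R) ^+ 2 :> R.
  by rewrite -natrD -natrX ler_nat; case: (s + d)%N => // k; rewrite -mulnn leq_pmulr.
have DN : d%:R ^+ 2 <= (s%:R + d%:R) ^+ 2 :> R.
  by rewrite lerXn2r ?nnegrE //; lra.
lra.
Qed.

(** * Bounds for the logarithm of the number of classes *)

Variables (p n : nat).
Hypotheses (p_pr : prime p) (p_odd : odd p).
Let lp : R := ln p%:R.

Lemma ln_prime_gt0 : 0 < lp.
Proof. by rewrite ln_gt0 // ltr1n prime_gt1. Qed.

Lemma ln_num_upper : (0 < num_powerfully_solvable p n)%N ->
  ln (num_powerfully_solvable p n)%:R <= (alpha * n%:R ^+ 3 + 2 * n%:R ^+ 2 + 1) * lp.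
Proof.
move=> num_gt0; have lp0 := ln_prime_gt0.
have p0 : 0 < p%:R :> R by rewrite ltr0n prime_gt0.
pose X : R := p%:R `^ (alpha * n%:R ^+ 3 + n%:R ^+ 2).
have X0 : 0 < X by apply: powR_gt0.
have leX : (num_powerfully_solvable p n)%:R <= n.+1%:R * X.
  have := num_upper n p_pr p_odd; rewrite -(ler_nat R) => /le_trans; apply.
  rewrite natr_sum -[n.+1 in leRHS]card_ord mulr_natl -sumr_const;
    apply: ler_sum => s _.
  rewrite natrX -powR_mulrn ?(ltW p0) // ler_powR ?ler1n ?prime_gt0 // natrD addrC.
  have lesn : (s <= n)%N by rewrite -ltnS.
  apply: lerD; first by have := param_count_upper s (n - s); rewrite subnKC.
  by rewrite -natrX ler_nat -mulnn leq_mul ?leq_subr.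
have : ln (num_powerfully_solvable p n)%:R <= ln (n.+1%:R * X).
  by rewrite ler_ln ?posrE ?ltr0n // mulr_gt0.
rewrite lnM ?posrE // ln_powR -/lp => /le_trans; apply.
(* The n + 1 possible values of s cost a factor of at most p^(n + 1), hence at most n^2 + 1 in the
   exponent. *)
have : ln n.+1%:R <= n.+1%:R * lp.
  rewrite mulr_natl -lnXn // ler_ln ?posrE ?exprn_gt0 // -natrX ler_nat.
  by apply: ltnW; apply: ltn_expl; apply: prime_gt1.
have : n.+1%:R * lp <= (n%:R ^+ 2 + 1) * lp.
  rewrite ler_pM2r // -natr1 lerD2r -natrX ler_nat.
  by case: (n) => // k; rewrite -mulnn leq_pmulr.
lra.
Qed.

Lemma ln_num_lower : (4 <= n)%N -> (0 < num_powerfully_solvable p n)%N /\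
  (alpha * n%:R ^+ 3 - 3 * n%:R ^+ 2) * lp <= ln (num_powerfully_solvable p n)%:R.
Proof.
move=> n4; have lp0 := ln_prime_gt0; have [qq /andP[q_ge q_le]] := sqrt2_bounds.
have p0 : 0 < p%:R :> R by rewrite ltr0n prime_gt0.
have N4 : 4 <= n%:R :> R by rewrite (ler_nat R 4).
have x0 : 0 <= (1 - q / 2) * n%:R by apply: mulr_ge0; lra.
(* Here s is the integer part of (1 - 1/sqrt 2) n, and t = n - 2 s. The condition n >= 4 makes s
   positive. *)
have /andP[] := Num.Theory.truncn_itv x0; set s := Num.truncn _ => sle slt.
have qN : 0 <= (3 / 2 - q) * n%:R by apply: mulr_ge0; lra.
have qN' : 0 <= (q - 7 / 5) * n%:R by apply: mulr_ge0; lra.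
have s_gt0 : (0 < s)%N by rewrite -ltnS -(ltr_nat R); lra.
have s2 : (2 * s <= n)%N by rewrite -(ler_nat R) natrM; lra.
have nE : n = (s + (n - 2 * s + s))%N by lia.
have := num_lower p_pr p_odd s_gt0 nE; set d := (n - 2 * s + s)%N in nE *;
  set N := num_powerfully_solvable p n => leN.
have N_gt0 : (0 < N)%N.
  by rewrite lt0n; apply: contraTneq leN => ->;
    rewrite mul0n -ltnNge expn_gt0 prime_gt0.
split=> //.
have lnp k : ln (p ^ k)%:R = k%:R * lp :> R by rewrite natrX lnXn // mulr_natl.
have : (param_count s d)%:R * lp <= ln N%:R + (n * d)%:R * lp.
  have pk k : 0 < (p ^ k)%:R :> R by rewrite ltr0n expn_gt0 prime_gt0.
  have N0 : 0 < N%:R :> R by rewrite ltr0n.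
  rewrite -!lnp -(lnM N0 (pk _)) -natrM expnM.
  by rewrite ler_ln ?posrE ?ltr0n ?muln_gt0 ?expn_gt0 ?N_gt0 ?prime_gt0 // ler_nat.
have : (alpha * n%:R ^+ 3 - 2 * n%:R ^+ 2) * lp <= (param_count s d)%:R * lp.
  rewrite ler_pM2r //; have := @param_count_lower s d.
  by rewrite -nE sle slt => -> //; rewrite /d leq_addl.
(* The fibre bound p^(n d) costs at most n^2 in the exponent. *)
have : (n * d)%:R * lp <= n%:R ^+ 2 * lp.
  by rewrite ler_pM2r // -natrX ler_nat -mulnn leq_mul2l {2}nE leq_addl orbT.
lra.
Qed.

End Estimates.

(** * The asymptotic formula *)

Local Open Scope classical_set_scope.

Theorem theorem5p1 (R : realType) (p : nat) (p_prime : prime p) (p_odd : odd p) :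
  exists2 e : nat -> R,
    e =o_\oo (fun n : nat => n%:R ^+ 3 : R) &
    \forall n \near \oo,
      (num_powerfully_solvable p n)%:R =
        p%:R `^ ((-1 + Num.sqrt 2) / 6 * n%:R ^+ 3 + e n) :> R.
Proof.
have lp0 : 0 < ln p%:R :> R by apply: ln_prime_gt0.
have p0 : 0 < p%:R :> R by rewrite ltr0n prime_gt0.
pose N n : R := (num_powerfully_solvable p n)%:R.
(* The logarithm to base p minus the cubic term, so that the equality holds as soon as N n is
   positive. *)
pose e n : R := ln (N n) / ln p%:R - (-1 + Num.sqrt 2) / 6 * n%:R ^+ 3.
have e_le n : (4 <= n)%N -> `|e n| <= 3 * n%:R ^+ 2.
  move=> n4; have [N_gt0 lo] := ln_num_lower R p_prime p_odd n4.
  have up := ln_num_upper R p_prime p_odd N_gt0.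
  have n1 : 1 <= n%:R ^+ 2 :> R by rewrite -natrX ler1n expn_gt0; apply/orP; left; lia.
  rewrite -/(N n) -ler_pdivlMr // in lo; rewrite -/(N n) -ler_pdivrMr // in up.
  by rewrite ler_norml /e; lra.
exists e.
  apply/eqoP => eps eps0; near=> n.
  have n4 : (4 <= n)%N by near: n; exact: nbhs_infty_ge.
  apply: le_trans (e_le n n4) _; rewrite ger0_norm ?exprn_ge0 //.
  (* The bound 3 n^2 is below eps n^3 once n >= 3 / eps. *)
  have -> : eps * n%:R ^+ 3 = eps * n%:R * n%:R ^+ 2 by ring.
  rewrite ler_wpM2r ?exprn_ge0 // -ler_pdivrMl //.
  by near: n; exact: nbhs_infty_ger.
near=> n; have n4 : (4 <= n)%N by near: n; exact: nbhs_infty_ge.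
have [N_gt0 _] := ln_num_lower R p_prime p_odd n4.
rewrite addrC subrK /powR gt_eqF //.
by rewrite divfK ?gt_eqF // lnK // posrE ltr0n.
Unshelve. all: by end_near.
Qed.
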